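(* Let $n\ge 1$ be an integer. For real numbers $a_1,\dots,a_n$ with $\sum_{j=1}^n a_j=1$ put $$C(t)=\sum_{j=1}^{n}a_j\cos jt,\qquad S(t)=\sum_{j=1}^{n}a_j\sin jt ,$$ and let $\mathcal T\subset(0,\pi)$ be the set of points of $(0,\pi)$ at which $S$ changes sign. Then $$\max_{a_1,\dots,a_n:\ \sum_{j=1}^n a_j=1}\ \min\left\{C(t):\ t\in\mathcal T\cup\{\pi\}\right\}=-\tan^2\frac{\pi}{2(n+1)},$$ and the coefficients of the extremal pair $(C,S)$ (a pair attaining the maximum) are determined uniquely by the formulas $$a_j^0=2\tan\frac{\pi}{2(n+1)}\cdot\left(1-\frac{j}{n+1}\right)\cdot\sin\frac{\pi j}{n+1},\qquad j=1,\dots,n .$$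
   Context: The function $S$ ''changes sign'' at a point $t_0$ if $S(t_0)=0$ and $S$ takes values of opposite signs immediately to the left and immediately to the right of $t_0$. *)

(* Defs.v *)
From mathcomp Require Import all_boot all_order all_algebra.
From mathcomp Require Import all_classical all_reals all_analysis.
Set Implicit Arguments.
Unset Strict Implicit.
Unset Printing Implicit Defensive.
Import Order.TTheory GRing.Theory Num.Theory.
Import numFieldNormedType.Exports.
Local Open Scope classical_set_scope.
Local Open Scope ring_scope.

(* A coefficient vector (a_1, ..., a_n) is a row vector a : 'rV[R]_n; the entry
   a 0 j with j : 'I_n is the coefficient a_{j+1}. *)

Definition cosPoly (R : realType) (n : nat) (a : 'rV[R]_n) (t : R) : R :=
  \sum_(j < n) a 0 j * cos (j.+1%:R * t).

Definition sinPoly (R : realType) (n : nat) (a : 'rV[R]_n) (t : R) : R :=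
  \sum_(j < n) a 0 j * sin (j.+1%:R * t).

Definition normalized (R : realType) (n : nat) (a : 'rV[R]_n) : Prop :=
  \sum_(j < n) a 0 j = 1.

Definition changes_sign_at (R : realType) (f : R -> R) (t0 : R) : Prop :=
  f t0 = 0 /\
  (((\forall t \near t0^'-, f t < 0) /\ (\forall t \near t0^'+, 0 < f t)) \/
   ((\forall t \near t0^'-, 0 < f t) /\ (\forall t \near t0^'+, f t < 0))).

Definition sign_changes (R : realType) (n : nat) (a : 'rV[R]_n) : set R :=
  [set t | 0 < t < pi /\ changes_sign_at (sinPoly a) t].

(* Attained minimum and maximum, as opposed to infimum and supremum. *)
Definition is_min (R : realType) (A : set R) (m : R) : Prop := A m /\ lbound A m.

Definition is_max (R : realType) (A : set R) (m : R) : Prop := A m /\ ubound A m.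

Definition is_min_value (R : realType) (n : nat) (a : 'rV[R]_n) (m : R) : Prop :=
  is_min (cosPoly a @` (sign_changes a `|` [set pi])) m.

Definition extremal_coeffs (R : realType) (n : nat) : 'rV[R]_n :=
  \row_(j < n) (2 * tan (pi / (2 * n.+1%:R)) * (1 - j.+1%:R / n.+1%:R)
                * sin (pi * j.+1%:R / n.+1%:R)).

(* Main.v *)
Require Import Defs.
From mathcomp Require Import all_boot all_order all_algebra.
From mathcomp Require Import all_classical all_reals all_analysis.
From mathcomp Require Import ring lra zify.
Set Implicit Arguments.
Unset Strict Implicit.
Unset Printing Implicit Defensive.
Import Order.TTheory GRing.Theory Num.Theory.
Import numFieldNormedType.Exports.
Local Open Scope classical_set_scope.
Local Open Scope ring_scope.

(** Write [S t = sin t * U (cos t)] with [U] of degree [< n], put [N = n + 1],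
    [c = cos (pi / N)], and let [L] be the Gauss-Chebyshev rule with the [N]
    nodes [cos ((2k + 1) pi / N)], all of which lie in [[-1, c]].  Whenever
    [(1 - X^2) U = (X - cos t) W] one has [C t = - L W].  This covers [t = 0],
    [t = pi] and every zero of [S], so the problem becomes one about [L].

    Factor [U = e A (X - x_0) ... (X - x_(r-1))] where [e] is a sign, [A >= 0] on
    [[-1, c]] and the [x_i], decreasing in [(-1, c)], are cosines of sign changes;
    put [x_r = -1], [w = prod (X - x_i)] and [w_i = w / (X - x_i)].  With
    [E p = e L (A p)], normalization reads [E w = 1], and a lower bound [- mu] for
    [C] at the sign changes and at [pi] reads [(1 - x_i) E w_i <= 1 + mu].  If the
    [y_i] interlace the [x_i], then [P = prod (X - y_i)] equals [w] minus a
    nonnegative combination of the [w_i], whence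
    [E P >= 1 - (1 + mu) (1 - P 1 / w 1)].  For [mu = tan^2 (pi / (2N))], that is
    [1 + mu = 2 / (1 + c)], the right-hand side is positive unless [e = 1] and
    [r = 0] for a choice of [y] that doubles up the roots, while that same choice
    fixes the sign of [e P] on the nodes and forces [E P <= 0].

    In the remaining case [L ((c - X) U) <= 0] with [U >= 0] on [[-1, c]], so [U]
    vanishes at every node other than [c], doubly at the interior ones, which
    determines it up to a factor.  The vector [a^0] has these properties because its
    sine polynomial is a difference of two translates of the Fejer kernel. *)

(** * Chebyshev polynomials and the Gauss-Chebyshev rule *)

Section ChebyshevQuadrature.
Context {R : realType}.
Implicit Types (x t : R) (p q : {poly R}) (j k n : nat).

(** The Chebyshev polynomial of the second kind of degree [j - 1]; the shifted index matches the
    frequency in [sin (j t)]. *)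
Fixpoint chebU j : {poly R} :=
  if j is k.+1 then
    if k is l.+1 then 2%:P * 'X * chebU k - chebU l else 1
  else 0.

Lemma chebU0 : chebU 0 = 0. Proof. by []. Qed.

Lemma chebU1 : chebU 1 = 1. Proof. by []. Qed.

Lemma chebUS j : chebU j.+2 = 2%:P * 'X * chebU j.+1 - chebU j.
Proof. by []. Qed.

Lemma horner_chebU j t : sin t * (chebU j).[cos t] = sin (j%:R * t).
Proof.
elim/ltn_ind: j => -[|[|j]] IH.
- by rewrite chebU0 horner0 mulr0 mul0r sin0.
- by rewrite chebU1 hornerC mulr1 mul1r.
rewrite chebUS !hornerE mulrBr IH //.
have -> : sin t * (2 * cos t * (chebU j.+1).[cos t]) =
          2 * cos t * (sin t * (chebU j.+1).[cos t]) by ring.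
rewrite IH //.
have -> : j.+2%:R * t = j.+1%:R * t + t by rewrite [j.+2%:R]mulrSr mulrDl mul1r.
have -> : j%:R * t = j.+1%:R * t - t by rewrite [j.+1%:R]mulrSr mulrDl mul1r addrK.
by rewrite sinB sinD; ring.
Qed.

Lemma size_chebU j : size (chebU j) = j.
Proof.
elim/ltn_ind: j => -[|[|j]] IH; rewrite ?chebU0 ?chebU1 ?size_poly0 ?size_poly1 //.
have U0 : chebU j.+1 != 0 by rewrite -size_poly_gt0 IH.
have sU : size (2%:P * 'X * chebU j.+1) = j.+2.
  rewrite -mulrA mul_polyC size_scale ?pnatr_eq0 //.
  by rewrite mulrC size_mulX // IH.
rewrite chebUS size_polyDl sU // size_polyN IH //.
Qed.

Lemma size_free_sum_eq0 n (p : nat -> {poly R}) (d : 'I_n -> R) :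
  (forall j, (j < n)%N -> size (p j) = j.+1) ->
  \sum_(j < n) d j *: p j = 0 -> forall j : 'I_n, d j = 0.
Proof.
elim: n d => [|n IH] d sp; first by move=> _ [].
rewrite big_ord_recr /= => s0.
have dn0 : d ord_max = 0.
  have := congr1 (fun q : {poly R} => q`_n) s0.
  rewrite /= coefD coefZ coef0 nth_default ?add0r; last first.
    apply: (leq_trans (size_sum _ _ _)); apply/bigmax_leqP => i _.
    apply: (leq_trans (size_scale_leq _ _)).
    by rewrite sp //= (leq_trans (ltn_ord i)).
  have -> : (p n)`_n = lead_coef (p n) by rewrite /lead_coef sp.
  move/eqP; rewrite mulf_eq0 lead_coef_eq0 -size_poly_eq0 sp //= orbF.
  by move/eqP.
move: s0; rewrite dn0 scale0r addr0 => s0 j.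
have := ltn_ord j; rewrite ltnS leq_eqVlt => /predU1P[jn|jn].
  by rewrite (_ : j = ord_max) //; apply/val_inj.
have -> : j = widen_ord (leqnSn n) (Ordinal jn) by apply/val_inj.
pose d' (i : 'I_n) := d (widen_ord (leqnSn n) i).
have spn k : (k < n)%N -> size (p k) = k.+1 by move=> kn; apply: sp; apply: ltnW.
exact: (IH d' spn s0 (Ordinal jn)).
Qed.

Definition sinQuot n (a : 'rV[R]_n) : {poly R} := \sum_(j < n) a 0 j *: chebU j.+1.

Lemma sinPolyE n (a : 'rV[R]_n) t : sinPoly a t = sin t * (sinQuot a).[cos t].
Proof.
rewrite /sinPoly /sinQuot horner_sum mulr_sumr; apply: eq_bigr => j _.
by rewrite hornerZ mulrCA horner_chebU.
Qed.

Lemma size_sinQuot n (a : 'rV[R]_n) : (size (sinQuot a) <= n)%N.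
Proof.
apply: (leq_trans (size_sum _ _ _)); apply/bigmax_leqP => i _.
by apply: (leq_trans (size_scale_leq _ _)); rewrite size_chebU.
Qed.

(** Passes from uniqueness of the polynomial [U] of the overview to uniqueness of the coefficient
    vector. *)
Lemma sinQuot_inj n : injective (@sinQuot n).
Proof.
move=> a b /eqP; rewrite -subr_eq0 -sumrB => /eqP ab.
apply/rowP => j; apply/eqP; rewrite -subr_eq0; apply/eqP.
pose d (i : 'I_n) := a 0 i - b 0 i; rewrite -/(d j).
have d0 : \sum_(i < n) d i *: chebU i.+1 = 0.
  by rewrite -[RHS]ab; apply: eq_bigr => i _; rewrite scalerBl.
exact: (size_free_sum_eq0 (p := fun j => chebU j.+1) (fun i _ => size_chebU i.+1) d0).
Qed.

(* The nodes are the zeros of T_(n+1); [quad n] is the corresponding Gauss rule,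
   exact against dx / sqrt (1 - x^2). *)
Definition angle n k : R := k.*2.+1%:R * (pi / n.+1%:R).
Definition node n k : R := cos (angle n k).
Definition quad n p : R := n.+1%:R^-1 * \sum_(k < n.+1) p.[node n k].

Lemma quadD n p q : quad n (p + q) = quad n p + quad n q.
Proof.
rewrite /quad -mulrDr -big_split; congr (_ * _).
by apply: eq_bigr => k _; rewrite hornerD.
Qed.

Lemma quadZ n (c : R) p : quad n (c *: p) = c * quad n p.
Proof.
rewrite /quad [RHS]mulrCA; congr (_ * _); rewrite mulr_sumr.
by apply: eq_bigr => k _; rewrite hornerZ.
Qed.

Lemma quad0 n : quad n 0 = 0.
Proof. by rewrite -(scale0r 0) quadZ mul0r. Qed.

Lemma quadN n p : quad n (- p) = - quad n p.
Proof. by rewrite -scaleN1r quadZ mulN1r. Qed.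

Lemma quadB n p q : quad n (p - q) = quad n p - quad n q.
Proof. by rewrite quadD quadN. Qed.

Lemma quad_sum n (I : Type) (r : seq I) (P : pred I) (F : I -> {poly R}) :
  quad n (\sum_(i <- r | P i) F i) = \sum_(i <- r | P i) quad n (F i).
Proof.
by elim/big_rec2: _ => [|i x p _ <-]; [exact: quad0 | exact: quadD].
Qed.

Lemma quadC n (c : R) : quad n c%:P = c.
Proof.
rewrite /quad (eq_bigr (fun=> c)) => [|k _]; last by rewrite hornerC.
by rewrite sumr_const card_ord -[c *+ _]mulr_natl mulKf // pnatr_eq0.
Qed.

Lemma quad_ge0 n p : (forall k, (k < n.+1)%N -> 0 <= p.[node n k]) -> 0 <= quad n p.
Proof. by move=> p0; apply: mulr_ge0 => //; apply: sumr_ge0 => k _; exact: p0. Qed.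

Lemma quad_eq0 n p : (forall k, (k < n.+1)%N -> 0 <= p.[node n k]) ->
  quad n p = 0 -> forall k, (k < n.+1)%N -> p.[node n k] = 0.
Proof.
move=> p0 /eqP; rewrite mulf_eq0 invr_eq0 pnatr_eq0 /= => q0 k kn.
have := psumr_eq0P (fun (i : 'I_n.+1) _ => p0 i (ltn_ord i)) (eqP q0).
by move/(_ (Ordinal kn) isT).
Qed.

(** Multiplied by [2 sin (m pi / N)], each cosine becomes a difference of sines, and the sum
    telescopes to zero by periodicity; [0 < m < N] keeps the multiplier nonzero. *)
Lemma sum_cos_angle n m : (0 < m < n.+1)%N ->
  \sum_(k < n.+1) cos (m%:R * angle n k) = 0.
Proof.
move=> /andP[m0 mn]; set al : R := pi / n.+1%:R.
have s0 : 0 < sin (m%:R * al).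
  apply: sin_gt0_pi; rewrite /al mulr_gt0 ?ltr0n ?divr_gt0 ?pi_gt0 //=.
  by rewrite mulrA ltr_pdivrMr ?ltr0n // mulrC ltr_pM2l ?pi_gt0 // ltr_nat.
have s2 : 2 * sin (m%:R * al) != 0 by rewrite mulf_neq0 ?pnatr_eq0 ?lt0r_neq0.
apply: (mulfI s2); rewrite mulr0.
pose f k := sin (m%:R * (k.*2%:R * al)).
have -> : 2 * sin (m%:R * al) * \sum_(k < n.+1) cos (m%:R * angle n k) =
          \sum_(0 <= k < n.+1) (f k.+1 - f k).
  rewrite mulr_sumr big_mkord; apply: eq_bigr => k _.
  rewrite /f /angle -/al doubleS.
  have -> : m%:R * (k.*2.+2%:R * al) = m%:R * (k.*2.+1%:R * al) + m%:R * al.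
    by rewrite -[k.*2.+2]addn1 natrD; ring.
  have -> : m%:R * (k.*2%:R * al) = m%:R * (k.*2.+1%:R * al) - m%:R * al.
    by rewrite -[k.*2.+1]addn1 natrD; ring.
  by rewrite sinB sinD; ring.
rewrite telescope_sumr // /f double0 mul0r mulr0 sin0 subr0.
have -> : m%:R * (n.+1.*2%:R * al) = 0 + pi *+ 2 *+ m.
  rewrite add0r -[RHS]mulr_natl -[pi *+ 2]mulr_natl -muln2 natrM /al.
  by field; rewrite nat1r pnatr_eq0.
by rewrite periodicn ?sin0 //; exact: sinD2pi.
Qed.

Let G j : {poly R} := (1 - 'X^2) * chebU j.

Let G_node j t : (G j).[cos t] = sin t * sin (j%:R * t).
Proof. by rewrite -horner_chebU mulrA -expr2 sin2cos2 !hornerE. Qed.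

(** [sin t sin (j t)] is half a difference of cosines of frequencies [j - 1] and [j + 1]. Since
    [j < n] keeps both below [N], only the constant term present for [j = 1] survives. *)
Let quad_G n j : (j < n)%N -> quad n (G j) = (j == 1%N)%:R / 2.
Proof.
case: j => [|j] jn; first by rewrite /G chebU0 mulr0 quad0 mul0r.
have E k : (G j.+1).[node n k] =
    (cos (j%:R * angle n k) - cos (j.+2%:R * angle n k)) / 2.
  rewrite G_node; set t := angle n k.
  have -> : j.+2%:R * t = j.+1%:R * t + t by rewrite [j.+2%:R]mulrSr mulrDl mul1r.
  have -> : j%:R * t = j.+1%:R * t - t by rewrite [j.+1%:R]mulrSr mulrDl mul1r addrK.
  by rewrite cosB cosD; field.
rewrite /quad; under eq_bigr => k _ do rewrite E.
rewrite -mulr_suml sumrB.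
rewrite [X in _ - X]sum_cos_angle // subr0.
case: j jn {E} => [|j] jn.
  rewrite (eq_bigr (fun=> 1)) => [|k _]; last by rewrite mul0r cos0.
  by rewrite sumr_const card_ord mulrA mulVf ?mul1r // pnatr_eq0.
by rewrite sum_cos_angle ?mul0r ?mulr0 //= ltnW // ltnW.
Qed.

(* [D y j] is the divided difference [(G j - (G j).[y]) / ('X - y)]. *)
Let D (y : R) := fix D j : {poly R} :=
  if j is k.+1 then
    if k is l.+1 then (2 * y) *: D k + 2%:P * G k - D l else - ('X + y%:P)
  else 0.

Let DE y j : ('X - y%:P) * D y j = G j - ((G j).[y])%:P.
Proof.
elim/ltn_ind: j => -[|[|j]] IH.
- by rewrite /= /G !mulr0 horner0 subr0.
- by rewrite /= /G chebU1 !hornerE !polyCB polyC_exp; ring.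
have -> : D y j.+2 = (2 * y) *: D y j.+1 + 2%:P * G j.+1 - D y j by [].
have GE : G j.+2 = 2%:P * 'X * G j.+1 - G j by rewrite /G chebUS; ring.
have Gy : (G j.+2).[y] = 2 * y * (G j.+1).[y] - (G j).[y].
  by rewrite GE hornerD hornerN hornerM hornerMX hornerC.
rewrite mulrBr mulrDr -scalerAr !IH // Gy GE -mul_polyC !(polyCB, polyCM); ring.
Qed.

(** Under [quad] the recurrence of [D] becomes that of [- cos (j t)]; the contribution of [G 1]
    makes up for [D y 0] being [0] instead of [-1]. *)
Let quad_D n t j : (0 < j <= n)%N -> quad n (D (cos t) j) = - cos (j%:R * t).
Proof.
elim/ltn_ind: j => -[|[|j]] IH // /andP[_ jn].
  rewrite quadN quadD quadC mul1r -[quad n 'X]mulr1 mulr1.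
  rewrite /quad (eq_bigr (fun k : 'I__ => cos (1%:R * angle n k))) => [|k _].
    by rewrite sum_cos_angle // mulr0 add0r.
  by rewrite hornerX mul1r.
have -> : D (cos t) j.+2 = (2 * cos t) *: D (cos t) j.+1 + 2 *: G j.+1 - D (cos t) j.
  by rewrite -mul_polyC.
rewrite quadB quadD !quadZ. rewrite (IH j.+1) ?(ltnW jn) //. rewrite quad_G //.
have E : j.+2%:R * t = j.+1%:R * t + t by rewrite [j.+2%:R]mulrSr mulrDl mul1r.
case: j jn IH E => [|j] jn IH E.
  rewrite quad0 E !mul1r cosD -!expr2 sin2cos2 divff ?pnatr_eq0 //. ring.
rewrite (IH j.+1) ?ltnS ?leqnSn //=; last exact: ltnW (ltnW jn). rewrite E mul0r mulr0.
have -> : j.+1%:R * t = j.+2%:R * t - t by rewrite [j.+2%:R]mulrSr mulrDl mul1r addrK.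
by rewrite cosB cosD; ring.
Qed.

(** [W] is the divided difference of [(1 - X^2) U] at [cos t], hence a combination of the
    [D (cos t) j.+1] with the coefficients of [a]. *)
Lemma cosPoly_quad n (a : 'rV[R]_n) t W :
  (1 - 'X^2) * sinQuot a = ('X - (cos t)%:P) * W -> cosPoly a t = - quad n W.
Proof.
move=> aW; have -> : W = \sum_(j < n) a 0 j *: D (cos t) j.+1.
  have /mulfI : 'X - (cos t)%:P != 0 by rewrite polyXsubC_eq0.
  apply; rewrite -aW mulr_sumr /sinQuot mulr_sumr.
  under [RHS]eq_bigr => j _ do rewrite -scalerAr DE scalerBr scale_polyC.
  (* The remainders left by [DE] add up to the value of [(1 - X^2) U] at [cos t], which is zero by
     [aW]. *)
  have y0 : \sum_(j < n) (a 0 j * (G j.+1).[cos t])%:P = 0.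
    have := congr1 (horner^~ (cos t)) aW.
    rewrite /= hornerM [RHS]hornerM hornerXsubC subrr mul0r => E.
    rewrite -rmorph_sum /= -[RHS]polyC0; congr _%:P; rewrite -[RHS]E.
    rewrite horner_sum mulr_sumr; apply: eq_bigr => j _.
    by rewrite hornerM hornerZ mulrCA.
  by rewrite sumrB y0 subr0; apply: eq_bigr => j _; rewrite -scalerAr.
rewrite quad_sum /cosPoly -sumrN; apply: eq_bigr => j _.
by rewrite quadZ quad_D ?ltn_ord // mulrN opprK.
Qed.
End ChebyshevQuadrature.

(** * Order and symmetry of the nodes *)

Section Nodes.
Context {R : realType}.
Implicit Types (n k : nat).

Lemma node0 n : node n 0 = cos (pi / n.+1%:R) :> R.
Proof. by rewrite /node /angle mul1r. Qed.

(** The angles of indices [k] and [n - k] add up to [2 pi]. *)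
Lemma node_rev n k : (k <= n)%N -> node n (n - k) = node n k :> R.
Proof.
move=> kn; rewrite /node -[RHS]cosN.
have -> : angle n (n - k) = - angle n k + pi *+ 2 :> R.
  have N0 : n.+1%:R != 0 :> R by rewrite pnatr_eq0.
  rewrite /angle -!muln2 !(mulrSr, natrM) natrB // in N0 *.
  by field.
by rewrite cosD2pi.
Qed.

Lemma angle_itv n k : (k.*2 <= n)%N -> angle n k \in `[0, pi : R].
Proof.
move=> kn; rewrite in_itv /= /angle mulr_ge0 ?divr_ge0 ?pi_ge0 //=.
by rewrite mulrA ler_pdivrMr ?ltr0n // mulrC ler_wpM2l ?pi_ge0 // ler_nat.
Qed.

Lemma angle_lt n j k : (j < k)%N -> angle n j < angle n k :> R.
Proof.
by move=> jk; rewrite /angle ltr_pM2r ?divr_gt0 ?pi_gt0 // ltr_nat ltnS ltn_double.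
Qed.

Lemma node_lt n j k : (j < k)%N -> (k.*2 <= n)%N -> node n k < node n j :> R.
Proof.
move=> jk kn; rewrite ltr_cos ?angle_lt ?angle_itv //.
by rewrite (leq_trans _ kn) // leq_double ltnW.
Qed.

Lemma node_half n k : (k <= n)%N -> exists2 j, (j.*2 <= n)%N & node n k = node n j :> R.
Proof.
move=> kn; have [kn2|kn2] := leqP k.*2 n; first by exists k.
by exists (n - k)%N; [lia | rewrite node_rev].
Qed.

Lemma node_le n k : (k <= n)%N -> node n k <= node n 0 :> R.
Proof.
move=> /node_half [[|j] jn -> //].
by rewrite ltW // node_lt.
Qed.

Lemma node_ge n k : -1 <= node n k :> R. Proof. exact: cos_geN1. Qed.

Lemma node0_lt1 n : node n 0 < 1 :> R.
Proof.
rewrite -cos0 ltr_cos ?in_itv /= ?lexx ?pi_ge0 //; last exact: angle_itv.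
by rewrite /angle mul1r divr_gt0 ?pi_gt0.
Qed.

Lemma node0_ge0 n : (0 < n)%N -> 0 <= node n 0 :> R.
Proof.
move=> n0; rewrite node0; apply: cos_ge0_pihalf; apply/andP; split.
  by rewrite (@le_trans _ _ 0) ?oppr_le0 ?divr_ge0 ?pi_ge0.
by rewrite ler_wpM2l ?pi_ge0 // lef_pV2 ?posrE ?ltr0n // ler_nat.
Qed.

(** Half-angle formula; it makes the [mu] of the overview a rational function of [c]. *)
Lemma tan_half n : (0 < n)%N -> let c := node n 0 in
  tan (pi / (2 * n.+1%:R)) ^+ 2 = (1 - c) / (1 + c) :> R.
Proof.
move=> n0 c; set h : R := pi / _.
have cE : c = 2 * cos h ^+ 2 - 1.
  rewrite /c node0 mulr_natl -cos_mulr2n -[h *+ 2]mulr_natl /h.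
  have N0 : n.+1%:R != 0 :> R by rewrite pnatr_eq0.
  congr cos; move: (n.+1%:R) N0 => N N0; by field.
have c0 : 0 <= c := node0_ge0 n0.
have h0 : cos h != 0.
  by apply: contraTneq c0 => h0; rewrite cE h0 expr0n mulr0 sub0r -ltNge ltrN10.
rewrite /tan expr_div_n sin2cos2 cE; field.
rewrite h0 /=.
have -> : 1 + (2 * cos h ^+ 2 - 1) = 2 * cos h ^+ 2 by ring.
by rewrite mulf_neq0 ?expf_neq0 ?pnatr_eq0.
Qed.

End Nodes.

(** * Signs and multiple roots of real polynomials on an interval *)

Section RealPolynomials.
Context {R : realType}.
Implicit Types (x y b lo hi : R) (p q A : {poly R}) (s : seq R).

(** Roots in [[lo, hi]] are split off one at a time. A factor at an endpoint has constant sign and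
    joins [A], an interior root already in [s] leaves it as a square in [A], and a polynomial
    without roots has constant sign. So [s] collects the interior roots of odd multiplicity. *)
Lemma poly_sign_factor p lo hi : p != 0 -> lo < hi ->
  exists (e : bool) s A,
  [/\ p = (-1) ^+ e *: (A * \prod_(x <- s) ('X - x%:P)), uniq s,
      {in s, forall x, lo < x < hi} & forall x, lo <= x <= hi -> 0 <= A.[x]].
Proof.
have [d] := ubnP (size p); elim: d p => // d IH p sp p0 lohi.
have [[r [rI /factor_theorem [q pq]]]|noroot] :=
    pselect (exists r, lo <= r <= hi /\ root p r); last first.
  exists (p.[lo] < 0), [::], ((-1) ^+ (p.[lo] < 0)%R *: p); split=> //.
    by rewrite big_nil mulr1 scalerA -expr2 sqrr_sign scale1r.
  move=> x xI; set A := _ *: p; have Alo : 0 <= A.[lo].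
    by rewrite /A hornerZ; case: ltP => h; rewrite ?mulN1r ?mul1r // oppr_ge0 ltW.
  rewrite leNgt; apply/negP => Ax; apply: noroot.
  have [||r rI rA] := @poly_ivt _ (- A) lo x; first by case/andP: xI.
    by rewrite !hornerN oppr_le0 oppr_ge0 Alo ltW.
  exists r; split; first by move: rI xI => /andP[-> ?] /andP[_]; apply: le_trans.
  by move: rA; rewrite rootN /A rootZ // signr_eq0.
have q0 : q != 0 by apply: contraNneq p0 => q0; rewrite pq q0 mul0r.
have sq : (size q < d)%N.
  by move: sp; rewrite pq size_Mmonic ?monicXsubC // size_XsubC addn2.
have [e [s [A [qE us sI A0]]]] := IH q sq q0 lohi.
have [rlo|rlo] := eqVneq r lo.
  exists e, s, (A * ('X - r%:P)); split=> // [|x xI].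
    by rewrite pq qE -scalerAl mulrAC.
  by rewrite hornerM hornerXsubC mulr_ge0 ?A0 // subr_ge0 rlo; case/andP: xI.
have [rhi|rhi] := eqVneq r hi.
  exists (~~ e), s, (A * (r%:P - 'X)); split=> // [|x xI].
    rewrite pq qE -scalerAl mulrAC signrN scaleNr -scalerN -mulNr -mulrN opprB.
    by [].
  by rewrite hornerM !hornerE mulr_ge0 ?A0 // subr_ge0 rhi; case/andP: xI.
have rI' : lo < r < hi by case/andP: rI => ? ?; rewrite !lt_neqAle eq_sym rlo rhi; apply/andP.
have [rs|rs] := boolP (r \in s).
  exists e, (rem r s), (A * ('X - r%:P) ^+ 2); split=> [|||x xI].
  - by rewrite pq qE (big_rem r) //= -scalerAl; congr (_ *: _); ring.
  - exact: rem_uniq.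
  - by move=> x /mem_rem; apply: sI.
  by rewrite hornerM horner_exp mulr_ge0 ?A0 // sqr_ge0.
exists e, (r :: s), A; split=> //=; first by rewrite pq qE big_cons -scalerAl; congr (_ *: _); ring.
- by rewrite rs.
by move=> x; rewrite inE => /predU1P[->|/sI].
Qed.

Lemma poly_roots_seq p : p != 0 -> exists s : seq R, forall x, root p x -> x \in s.
Proof.
have [d] := ubnP (size p); elim: d p => // d IH p sp p0.
have [[r /factor_theorem [q pq]]|noroot] := pselect (exists r, root p r); last first.
  by exists [::] => x rx; case: noroot; exists x.
have q0 : q != 0 by apply: contraNneq p0 => q0; rewrite pq q0 mul0r.
have sq : (size q < d)%N.
  by move: sp; rewrite pq size_Mmonic ?monicXsubC // size_XsubC addn2.
have [s sP] := IH q sq q0.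
exists (r :: s) => x; rewrite pq rootM root_XsubC inE => /orP[/sP->|->//].
by rewrite orbT.
Qed.

Lemma near_notroot p b : p != 0 -> \forall x \near b, x != b -> p.[x] != 0.
Proof.
move=> /poly_roots_seq [s sP].
suff : \forall x \near b, x != b -> x \notin s.
  by apply: filterS => x /[apply]; apply: contraNneq => px; apply: sP; rewrite rootE px.
elim: s {sP} => [|r s IH]; first by near=> x.
have [->|br] := eqVneq r b.
  by near=> x => xb; rewrite inE negb_or xb /=; move: xb; near: x.
have nr : \forall x \near b, x != r by apply: open_neq => //=; rewrite eq_sym.
by apply: filterS2 IH nr => x xs xr /xs xns; rewrite inE negb_or xr.
Unshelve. all: by end_near. Qed.

Lemma horner_cvg p b : p.[x] @[x --> b] --> p.[b].
Proof. exact: continuous_horner. Qed.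

Lemma horner_ge0_left p lo b : lo < b ->
  (forall x, lo < x < b -> 0 <= p.[x]) -> 0 <= p.[b].
Proof.
move=> lob p0; rewrite leNgt; apply/negP => pb.
have : \forall x \near b^'-, p.[x] < 0.
  have := cvg_at_left_filter (@horner_cvg p b); by move/(cvgr_lt _); apply.
move=> pn; have /filter_ex [x [px xb]] : \forall x \near b^'-, p.[x] < 0 /\ lo < x < b.
  near=> x; split; first by near: x.
  by apply/andP; split; near: x; [exact: nbhs_left_gt | exact: nbhs_left_lt].
by move: (p0 x xb); rewrite leNgt px.
Unshelve. all: by end_near. Qed.

Lemma horner_ge0_right p b hi : b < hi ->
  (forall x, b < x < hi -> 0 <= p.[x]) -> 0 <= p.[b].
Proof.
move=> bhi p0; have := @horner_ge0_left (p \Po (- 'X)) (- hi) (- b).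
rewrite !horner_comp !hornerE opprK; apply; first by rewrite ltrN2.
by move=> x xI; rewrite !horner_comp !hornerE p0 // ltrNr ltrNl andbC.
Qed.

(** The quotient [p / (X - b)] is nonnegative to the right of [b] and nonpositive to its left, so by
    continuity it vanishes at [b] and a second factor splits off. *)
Lemma poly_double_roots p s lo hi : uniq s -> {in s, forall x, lo < x < hi} ->
  (forall x, lo < x < hi -> 0 <= p.[x]) -> {in s, forall x, p.[x] = 0} ->
  exists q, p = q * \prod_(x <- s) ('X - x%:P) ^+ 2.
Proof.
elim: s p => [|b s IH] p; first by move=> *; exists p; rewrite big_nil mulr1.
move=> /= /andP[bs us] sI p0 ps.
have /andP[lob bhi] : lo < b < hi by apply: sI; rewrite mem_head.
have /factor_theorem [q pq] : root p b by rewrite rootE ps ?mem_head.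
have qr x : b < x < hi -> 0 <= q.[x].
  move=> /andP[bx xhi]; have : 0 <= p.[x] by rewrite p0 // xhi (lt_trans lob).
  by rewrite pq hornerM hornerXsubC pmulr_lge0 // subr_gt0.
have ql x : lo < x < b -> 0 <= (- q).[x].
  move=> /andP[lox xb]; have : 0 <= p.[x] by rewrite p0 // lox (lt_trans xb).
  by rewrite pq hornerM hornerXsubC nmulr_lge0 ?subr_lt0 // hornerN oppr_ge0.
have qb : q.[b] = 0.
  apply/eqP; rewrite eq_le (horner_ge0_right bhi qr) andbT.
  by have := horner_ge0_left lob ql; rewrite hornerN oppr_ge0.
have /factor_theorem [v qv] : root q b by rewrite rootE qb.
have pv : p = v * ('X - b%:P) ^+ 2 by rewrite pq qv; ring.
have v0 x : lo < x < hi -> x != b -> 0 <= v.[x].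
  move=> xI xb; have := p0 x xI; rewrite pv hornerM horner_exp hornerXsubC.
  by rewrite pmulr_lge0 // exprn_even_gt0 // subr_eq0.
have [x xI|x xI|x xs|w vw] := IH v us.
- by apply: sI; rewrite inE xI orbT.
- have [->|xb] := eqVneq x b; last exact: v0.
  apply: (horner_ge0_left lob) => y /andP[loy yb].
  by rewrite v0 ?loy ?(lt_trans yb) // lt_eqF.
- move: (ps x); rewrite inE xs orbT => /(_ isT) /eqP.
  rewrite pv hornerM horner_exp hornerXsubC mulf_eq0 expf_eq0 /= subr_eq0.
  by case/orP => [/eqP //|/eqP xb]; move: bs; rewrite -xb xs.
by exists w; rewrite big_cons pv vw; ring.
Qed.

Lemma near_sign_change p (e : bool) A s b lo hi :
  p = (-1) ^+ e *: (A * \prod_(x <- s) ('X - x%:P)) -> p != 0 ->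
  uniq s -> b \in s -> lo < b < hi -> (forall x, lo <= x <= hi -> 0 <= A.[x]) ->
  exists d : bool, \forall x \near b, x != b -> 0 < (-1) ^+ d * ((x - b) * p.[x]).
Proof.
move=> pE p0 us bs /andP[lob bhi] A0.
have A_neq0 : A != 0 by apply: contraNneq p0 => A00; rewrite pE A00 mul0r scaler0.
pose Z := \prod_(x <- rem b s) ('X - x%:P).
have Zb : Z.[b] != 0.
  rewrite horner_prod prodf_seq_neq0; apply/allP => x xs /=.
  rewrite hornerXsubC subr_eq0; apply: contraTneq xs => <-.
  by rewrite mem_rem_uniqF.
have Zn : \forall x \near b, 0 < Z.[x] * Z.[b].
  have /(cvgr_gt _) : Z.[x] * Z.[b] @[x --> b] --> Z.[b] * Z.[b].
    by apply: cvgMl; exact: horner_cvg.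
  by apply; rewrite -expr2 exprn_even_gt0.
(* The sign of [p] just right of [b] is that of [e] times the other root factors at [b]: [A] may
   vanish at [b], but it is positive at all other nearby points. *)
exists (e (+) (Z.[b] < 0)).
have An := near_notroot b A_neq0.
have bI : \forall x \near b, lo < x < hi.
  near=> x; apply/andP; split; near: x; [exact: lt_nbhsr | exact: lt_nbhsl].
apply: filterS3 An Zn bI => x Ax Zx /andP[lox xhi] xb.
have Axp : 0 < A.[x] by rewrite lt0r Ax // A0 // !ltW.
rewrite pE (big_rem b) //= -/Z hornerZ !hornerM hornerXsubC signr_addb.
have -> : (-1) ^+ e * (-1) ^+ (Z.[b] < 0)%R *
   ((x - b) * ((-1) ^+ e * (A.[x] * ((x - b) * Z.[x])))) =
   ((-1) ^+ e * (-1) ^+ e) * ((x - b) ^+ 2 * A.[x]) * ((-1) ^+ (Z.[b] < 0)%R * Z.[x]) by ring.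
rewrite -[_ * (-1) ^+ e]expr2 sqrr_sign mul1r mulr_gt0 //.
  by rewrite mulr_gt0 // exprn_even_gt0 // subr_eq0.
have [Zb0|Zb0] := ltP Z.[b] 0.
  by move: Zx; rewrite (nmulr_lgt0 _ Zb0) mulN1r oppr_gt0.
by move: Zx; rewrite pmulr_lgt0 ?mul1r // lt0r Zb.
Unshelve. all: by end_near. Qed.

End RealPolynomials.

(** * Interlacing root sequences and Lagrange expansion *)

Section Interlacing.
Context {R : realFieldType}.
Implicit Types (x y : nat -> R) (m k : nat).

Definition rootPoly m x : {poly R} := \prod_(i < m) ('X - (x i)%:P).
Definition rootPolyD1 m x (i : 'I_m) : {poly R} := \prod_(j < m | j != i) ('X - (x j)%:P).

Lemma rootPoly_D1 m x (i : 'I_m) : rootPoly m x = ('X - (x i)%:P) * rootPolyD1 x i.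
Proof. by rewrite /rootPoly (bigD1 i). Qed.

Lemma rootPoly_eq0 m x t : (rootPoly m x).[t] = 0 -> exists i : 'I_m, t = x i.
Proof.
move/eqP; rewrite horner_prod prodf_seq_eq0 => /hasP[i _ /=].
by rewrite hornerXsubC subr_eq0 => /eqP ->; exists i.
Qed.

(** Both products are monic of degree [m], so their difference has lower degree and is determined by
    its values at the [m] points [x i]. *)
Lemma rootPoly_lagrange m x y : (forall i j : 'I_m, x i = x j -> i = j) ->
  rootPoly m y = rootPoly m x +
    \sum_(i < m) ((rootPoly m y).[x i] / (rootPolyD1 x i).[x i]) *: rootPolyD1 x i.
Proof.
move=> xinj; set P := rootPoly m y; set w := rootPoly m x; set S := \sum_(i < m) _.
have D0 (i j : 'I_m) : j != i -> (rootPolyD1 x i).[x j] = 0.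
  by move=> ji; rewrite /rootPolyD1 (bigD1 j) //= hornerM hornerXsubC subrr mul0r.
have Dn0 (i : 'I_m) : (rootPolyD1 x i).[x i] != 0.
  rewrite horner_prod prodf_seq_neq0; apply/allP => j _; apply/implyP => ji.
  by rewrite hornerXsubC subr_eq0; apply: contraNneq ji => /xinj ->.
have sP z : size (rootPoly m z) = m.+1.
  by rewrite /rootPoly size_prod_XsubC /index_enum -enumT size_enum_ord.
have mP z : rootPoly m z \is monic by exact: monic_prod_XsubC.
have sD (i : 'I_m) : (size (rootPolyD1 x i) <= m)%N.
  have := sP x; rewrite (rootPoly_D1 x i) size_Mmonic; last first.
  - exact: monic_prod_XsubC.
  - by rewrite polyXsubC_eq0.
  by rewrite size_XsubC !addSn add0n /= => -[->].
have sPw : (size (P - w)%R <= m)%N.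
  rewrite -ltnS; case: (eqVneq (P - w) 0) => [->|Pw]; first by rewrite size_poly0.
  have sle : (size (P - w)%R <= m.+1)%N.
    by apply: leq_trans (size_polyD _ _) _; rewrite size_polyN !sP maxnn.
  rewrite ltn_neqAle sle andbT; apply: contraNneq Pw => sE.
  rewrite -lead_coef_eq0 /lead_coef sE /= coefB.
  have -> : P`_m = lead_coef P by rewrite /lead_coef sP.
  have -> : w`_m = lead_coef w by rewrite /lead_coef sP.
  by rewrite (monicP (mP y)) (monicP (mP x)) subrr.
apply/eqP; rewrite -subr_eq0 opprD addrA; apply/eqP.
apply: (@roots_geq_poly_eq0 _ _ [seq x i | i : 'I_m <- enum 'I_m]).
- apply/allP => _ /mapP[i _ ->]; rewrite rootE !hornerD !hornerN subr_eq0.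
  have -> : w.[x i] = 0 by rewrite /w (rootPoly_D1 x i) hornerM hornerXsubC subrr mul0r.
  rewrite subr0 horner_sum (bigD1 i) //= hornerZ divfK // big1 ?addr0 // => j ji.
  by rewrite hornerZ (D0 j i) ?mulr0 // eq_sym.
- by rewrite map_inj_uniq ?enum_uniq.
rewrite size_map size_enum_ord (leq_trans (size_polyD _ _)) // geq_max sPw size_polyN.
apply: (leq_trans (size_sum _ _ _)); apply/bigmax_leqP => i _.
exact: leq_trans (size_scale_leq _ _) (sD i).
Qed.

Section Functional.
Context (E : {poly R} -> R) (M : R) (m : nat) (x y : nat -> R).
Hypotheses (ED : forall p q, E (p + q) = E p + E q)
  (EZ : forall (a : R) p, E (a *: p) = a * E p).
Hypotheses (xdecr : forall i j, (i < j < m)%N -> x j < x i)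
  (x_lt1 : forall i, (i < m)%N -> x i < 1)
  (xy : forall i, (i < m)%N -> x i <= y i)
  (yx : forall i j, (i < j < m)%N -> y j <= x i).
Hypotheses (Ew : E (rootPoly m x) = 1)
  (ED1 : forall i : 'I_m, (1 - x i) * E (rootPolyD1 x i) <= M).

(* Expanding the second product in the Lagrange basis attached to the first one,
   interlacing makes every Lagrange coefficient nonpositive. *)
Lemma interlacing_functional_ge :
  1 - M * (1 - (rootPoly m y).[1] / (rootPoly m x).[1]) <= E (rootPoly m y).
Proof.
have xinj (i j : 'I_m) : x i = x j -> i = j.
  case: (ltngtP i j) => ij xij; last exact: val_inj.
    by have := @xdecr i j; rewrite ij ltn_ord => /(_ isT); rewrite xij ltxx.
  by have := @xdecr j i; rewrite ij ltn_ord => /(_ isT); rewrite xij ltxx.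
have E0 : E 0 = 0 by rewrite -(scale0r 0) EZ mul0r.
set P := rootPoly m y; set w := rootPoly m x.
pose r (i : 'I_m) := P.[x i] / (rootPolyD1 x i).[x i].
have PE : P = w + \sum_(i < m) r i *: rootPolyD1 x i := rootPoly_lagrange y xinj.
have EP : E P = 1 + \sum_(i < m) r i * E (rootPolyD1 x i).
  rewrite PE ED Ew; congr (_ + _).
  elim/big_rec2: _ => [|i a p _ <-]; first exact: E0.
  by rewrite ED EZ.
have r_le0 (i : 'I_m) : r i <= 0.
  have -> : r i = P.[x i] * (rootPolyD1 x i).[x i] * (rootPolyD1 x i).[x i] ^- 2.
    rewrite /r; have [->|D0] := eqVneq (rootPolyD1 x i).[x i] 0.
      by rewrite invr0 !mulr0 mul0r.
    by rewrite -exprVn -mulrA expr2 mulVKf.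
  rewrite mulr_le0_ge0 ?invr_ge0 ?sqr_ge0 //.
  (* The factor [x i - y i] is nonpositive; for [j != i], interlacing gives [x i - y j] and
     [x i - x j] the same weak sign. *)
  rewrite /P (rootPoly_D1 y i) hornerM hornerXsubC -mulrA mulr_le0_ge0 //.
    by rewrite subr_le0 xy.
  rewrite /rootPolyD1 !horner_prod -big_split /=; apply: prodr_ge0 => j ji.
  rewrite !hornerXsubC.
  case: (ltngtP i j) => ij; last by move: ji; rewrite -val_eqE /= ij eqxx.
    by rewrite mulr_ge0 // subr_ge0 ?yx ?ij //= ltW // xdecr ?ij /=.
  rewrite mulr_le0 // subr_le0; last by rewrite ltW // xdecr ?ij /=.
  by rewrite (le_trans _ (xy _)) // ltW // xdecr ?ij /=.
have x1 (i : 'I_m) : 0 < 1 - x i by rewrite subr_gt0 x_lt1.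
have w1 : w.[1] != 0.
  apply/negP => /eqP /rootPoly_eq0[i /esym/eqP].
  by rewrite lt_eqF ?x_lt1.
have D1 (i : 'I_m) : (rootPolyD1 x i).[1] = w.[1] / (1 - x i).
  by rewrite /w (rootPoly_D1 x i) hornerM hornerXsubC mulrC mulKf // gt_eqF.
(* Evaluation at [1] weights [r i] by [1 / (1 - x i)], the weight that also bounds
   [E (rootPolyD1 x i)] through [ED1]. *)
have P1 : P.[1] / w.[1] = 1 + \sum_(i < m) r i / (1 - x i).
  rewrite PE hornerD mulrDl mulfV //; congr (_ + _).
  rewrite horner_sum mulr_suml; apply: eq_bigr => i _.
  by rewrite hornerZ D1; field; rewrite w1 gt_eqF.
rewrite EP P1 opprD addrA subrr sub0r mulrN opprK lerD2l mulr_sumr.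
apply: ler_sum => i _; rewrite mulrCA ler_wnM2l //.
by rewrite ler_pdivlMr // mulrC.
Qed.

End Functional.

Section Ratio.
Context (k : nat) (x y : nat -> R).
Hypotheses (x1 : forall i, (i <= k)%N -> x i < 1) (xk : x k = -1)
  (yx : forall i, (i < k)%N -> y i.+1 <= x i) (y0 : y 0%N < 1).

Let A := \prod_(i < k) (1 - x i).
Let B := \prod_(i < k) (1 - y i.+1).

Let A_gt0 : 0 < A.
Proof. by apply: prodr_gt0 => i _; rewrite subr_gt0 x1 // ltnW. Qed.

(** Pairs [y 0] with [x k = -1], the source of the [2], and [y i.+1] with [x i], so that each factor
    of [B / A] is at least one. *)
Let ratioE : (rootPoly k.+1 y).[1] / (rootPoly k.+1 x).[1] = (1 - y 0%N) / 2 * (B / A).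
Proof.
have -> : (rootPoly k.+1 y).[1] = (1 - y 0%N) * B.
  rewrite /rootPoly big_ord_recl hornerM hornerXsubC horner_prod; congr (_ * _).
  by apply: eq_bigr => i _; rewrite hornerXsubC lift0.
have -> : (rootPoly k.+1 x).[1] = A * 2.
  rewrite /rootPoly big_ord_recr hornerM hornerXsubC /= xk opprK horner_prod; congr (_ * _).
  by apply: eq_bigr => i _; rewrite hornerXsubC.
by field; rewrite gt_eqF.
Qed.

Lemma rootPoly_ratio_ge :
  (1 - y 0%N) / 2 <= (rootPoly k.+1 y).[1] / (rootPoly k.+1 x).[1].
Proof.
rewrite ratioE ler_peMr ?divr_ge0 ?subr_ge0 ?(ltW y0) //.
rewrite ler_pdivlMr // mul1r; apply: ler_prod => i _.
by rewrite subr_ge0 lerD2l lerN2 yx // ltW // x1 // ltnW.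
Qed.

Lemma rootPoly_ratio_gt : (0 < k)%N -> y 1%N < x 0%N ->
  (1 - y 0%N) / 2 < (rootPoly k.+1 y).[1] / (rootPoly k.+1 x).[1].
Proof.
move=> k0 yx0; rewrite ratioE ltr_pMr ?divr_gt0 ?subr_gt0 //.
rewrite ltr_pdivlMr // mul1r /A /B; move: k0 x1 yx; case: (k) => // j _ x1' yx'.
have x1'' i : (i <= j.+1)%N -> 0 < 1 - x i by move=> ij; rewrite subr_gt0 x1'.
rewrite !big_ord_recl (@lt_le_trans _ _ ((1 - y 1%N) * \prod_(i < j) (1 - x (lift ord0 i)))) //.
  rewrite ltr_pM2r ?ltrD2l ?ltrN2 //; apply: prodr_gt0 => i _.
  by apply: x1''; rewrite lift0 ltnS ltnW.
rewrite ler_pM2l; last by rewrite (lt_trans (x1'' 0%N isT)) // ltrD2l ltrN2.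
apply: ler_prod => i _; rewrite lift0; apply/andP; split.
  by apply/ltW/x1''; rewrite ltnS ltnW.
by rewrite lerD2l lerN2 yx' // ltnS.
Qed.

End Ratio.

(* The sequence x_0, x_0, x_2, x_2, ...: the corresponding product is a square,
   up to a last unpaired factor. *)
Definition pairUp x (i : nat) := x i./2.*2.

Lemma prod_pairUp_ge0 m x t : (odd m -> x m.-1 <= t) ->
  0 <= \prod_(i < m) (t - pairUp x i).
Proof.
have even k : \prod_(i < k.*2) (t - pairUp x i) = \prod_(i < k) (t - x i.*2) ^+ 2.
  elim: k => [|k IH]; first by rewrite !big_ord0.
  by rewrite doubleS !big_ord_recr /= IH /pairUp /= uphalf_double doubleK -mulrA.
have := odd_double_half m; case: (odd m) => <-; last first.
  by rewrite /= ?add0n even prodr_ge0 // => i _; exact: sqr_ge0.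
rewrite /= ?add1n => /(_ isT) /= xt; rewrite big_ord_recr even /= mulr_ge0 //.
  by rewrite prodr_ge0 // => i _; exact: sqr_ge0.
by rewrite subr_ge0 /pairUp doubleK.
Qed.

End Interlacing.

(** * From a lower bound on [C] to the shape of [U] *)

Section UpperBound.
Context {R : realType}.
Implicit Types (n : nat) (t b : R).

(** On [(0, pi)] the sine is positive and the cosine decreases, so a sign change of [sinQuot a] at
    [b] carries over with the two sides exchanged. *)
Lemma acos_sign_change n (a : 'rV[R]_n) b (d : bool) : -1 < b < 1 ->
  root (sinQuot a) b ->
  (\forall x \near b, x != b -> 0 < (-1) ^+ d * ((x - b) * (sinQuot a).[x])) ->
  sign_changes a (acos b).
Proof.
move=> /andP[b1 b2] Ub0 Ub; set t0 := acos b.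
have t0gt : 0 < t0 by rewrite acos_gt0 // ltW.
have t0lt : t0 < pi by rewrite acos_ltpi // b1 ltW.
have ct0 : cos t0 = b by rewrite acosK // in_itv /= !ltW.
split; first by rewrite t0gt.
split; first by rewrite sinPolyE ct0 (rootP Ub0) mulr0.
have tI : \forall t \near t0, 0 < t < pi.
  near=> t; apply/andP; split; near: t; [exact: lt_nbhsr | exact: lt_nbhsl].
have cU : \forall t \near t0, cos t != b ->
    0 < (-1) ^+ d * ((cos t - b) * (sinQuot a).[cos t]).
  by have := @continuous_cos R t0; rewrite /continuous_at ct0 => /(_ _ Ub).
have L : \forall t \near t0^'-, 0 < (-1) ^+ d * sinPoly a t.
  rewrite /at_left near_withinE; apply: filterS2 tI cU => t /andP[t1 t2] Ut tt0.
  have ctb : b < cos t by rewrite -ct0 ltr_cos // in_itv /= !ltW.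
  have : 0 < (-1) ^+ d * ((cos t - b) * (sinQuot a).[cos t]) by rewrite Ut ?gt_eqF.
  rewrite mulrCA pmulr_rgt0 ?subr_gt0 // => h.
  by rewrite sinPolyE mulrCA pmulr_rgt0 ?sin_gt0_pi ?t1.
have L' : \forall t \near t0^'+, (-1) ^+ d * sinPoly a t < 0.
  rewrite /at_right near_withinE; apply: filterS2 tI cU => t /andP[t1 t2] Ut tt0.
  have ctb : cos t < b by rewrite -ct0 ltr_cos // in_itv /= !ltW.
  have : 0 < (-1) ^+ d * ((cos t - b) * (sinQuot a).[cos t]) by rewrite Ut ?lt_eqF.
  rewrite mulrCA nmulr_rgt0 ?subr_lt0 // => h.
  by rewrite sinPolyE mulrCA pmulr_rlt0 ?sin_gt0_pi ?t1.
case: d {Ub cU} L L' => L L'; [left | right]; split.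
- by apply: filterS L => t; rewrite mulN1r oppr_gt0.
- by apply: filterS L' => t; rewrite mulN1r oppr_lt0.
- by apply: filterS L => t; rewrite mul1r.
- by apply: filterS L' => t; rewrite mul1r.
Unshelve. all: by end_near. Qed.

Lemma cosPoly0 n (a : 'rV[R]_n) : normalized a -> cosPoly a 0 = 1.
Proof.
rewrite /normalized /cosPoly => <-; apply: eq_bigr => j _.
by rewrite mulr0 cos0 mulr1.
Qed.

Lemma cosPoly0_quad n (a : 'rV[R]_n) : cosPoly a 0 = quad n ((1 + 'X) * sinQuot a).
Proof.
rewrite (@cosPoly_quad _ _ a 0 (- ((1 + 'X) * sinQuot a))) ?quadN ?opprK //.
by rewrite cos0; ring.
Qed.

Lemma cosPolypi_quad n (a : 'rV[R]_n) : cosPoly a pi = - quad n ((1 - 'X) * sinQuot a).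
Proof.
by apply: cosPoly_quad; rewrite cospi polyCN; ring.
Qed.

Lemma extremal_quotient n (a : 'rV[R]_n) : (0 < n)%N -> normalized a ->
  let mu : R := (1 - node n 0) / (1 + node n 0) in
  (forall t, sign_changes a t -> - mu <= cosPoly a t) -> - mu <= cosPoly a pi ->
  (forall x, -1 <= x <= node n 0 -> 0 <= (sinQuot a).[x]) /\
  (forall k, (k <= n)%N -> node n k < node n 0 :> R -> (sinQuot a).[node n k] = 0).
Proof.
move=> n0 na; set c : R := node n 0; move=> mu Hs Hpi.
have c0 : 0 <= c := node0_ge0 n0.
have c1 : c < 1 := node0_lt1 n.
have q1 : quad n ((1 + 'X) * sinQuot a) = 1 by rewrite -cosPoly0_quad cosPoly0.
have U0 : sinQuot a != 0.
  by apply: contra_eqN q1 => /eqP ->; rewrite mulr0 quad0 eq_sym oner_eq0.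
have m1c : -1 < c by rewrite (lt_le_trans _ c0) // ltrN10.
have [e [s [A [UE us sI A0]]]] := poly_sign_factor U0 m1c.
have nodeI k : (k < n.+1)%N -> -1 <= (node n k : R) <= c.
  by move=> kn; rewrite node_ge node_le.
(* The roots in decreasing order; the default [-1] of [nth] makes [x r] the extra root that stands
   for [t = pi]. *)
pose r := size s; pose ds := rev (sort <=%O s); pose x i := nth (-1) ds i.
have ss : size ds = r by rewrite size_rev size_sort.
have dsp : perm_eq ds s by rewrite perm_rev perm_sort.
have xr : x r = -1 by rewrite /x nth_default ?ss.
have xs i : (i < r)%N -> x i \in s by move=> ir; rewrite -(perm_mem dsp) mem_nth ?ss.
have xI i : (i < r)%N -> -1 < x i < c by move/xs/sI.
have xdecr i j : (i < j < r.+1)%N -> x j < x i.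
  move=> /andP[ij]; rewrite ltnS leq_eqVlt => /predU1P[jr|jr].
    by rewrite jr xr; have /andP[] : -1 < x i < c by apply: xI; rewrite -jr.
  have so : sorted (fun u v : R => v < u) ds by rewrite rev_sorted sort_lt_sorted.
  have tr : transitive (fun u v : R => v < u) by move=> u v z uv vz; exact: lt_trans vz uv.
  by apply: (sorted_ltn_nth tr _ so); rewrite ?inE ?ss // (ltn_trans ij).
have xle i j : (i <= j <= r)%N -> x j <= x i.
  move=> /andP[]; rewrite leq_eqVlt => /predU1P[->//|ij jr].
  by rewrite ltW // xdecr // ij ltnS.
have x1 i : (i <= r)%N -> x i < 1.
  rewrite leq_eqVlt => /predU1P[->|/xI/andP[_]]; last by move/lt_trans; apply.
  by rewrite xr; lra.
have sx : \prod_(z <- s) ('X - z%:P) = rootPoly r x.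
  by rewrite -(perm_big _ dsp) /= (big_nth (-1)) big_mkord ss.
pose w := rootPoly r.+1 x.
have wE : w = rootPoly r x * (1 + 'X).
  by rewrite /w /rootPoly big_ord_recr /= xr polyCN opprK addrC.
pose E p := (-1) ^+ e * quad n (A * p).
have ED p q : E (p + q) = E p + E q by rewrite /E mulrDr quadD mulrDr.
have EZ (z : R) p : E (z *: p) = z * E p by rewrite /E -[A * _]scalerAr quadZ mulrCA.
have EN p : E (- p) = - E p by rewrite /E mulrN quadN mulrN.
have Ew : E w = 1.
  rewrite -q1 UE sx /E wE -quadZ; congr quad.
  by rewrite -!scalerAr; congr (_ *: _); ring.
have ED1 (i : 'I_r.+1) : (1 - x i) * E (rootPolyD1 x i) <= 1 + mu.
  have xi1 : -1 <= x i <= 1.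
    by rewrite -{1}xr xle ?leq_ord //= ltW // x1 // leq_ord.
  have ct : cos (acos (x i)) = x i by rewrite acosK // in_itv.
  have : - mu <= cosPoly a (acos (x i)).
    have := leq_ord i; rewrite leq_eqVlt => /predU1P[->|ir].
      by rewrite xr acosN1.
    apply: Hs; have /andP[xi0 xi2] := xI _ ir.
    have xis : x i \in s := xs _ ir.
    have [|d dP] := near_sign_change UE U0 us xis _ A0; first by rewrite xi0.
    apply: (@acos_sign_change _ _ _ d) => //; first by rewrite xi0 x1 // ltnW.
    by rewrite UE rootZ ?signr_eq0 // rootM root_prod_XsubC xis orbT.
  rewrite (@cosPoly_quad _ _ a _ ((-1) ^+ e *: (A * ((1 - 'X) * rootPolyD1 x i)))).
    rewrite lerN2 quadZ -/(E _).
    (* With [E w = 1], this identity makes [C] at [acos (x i)] equal to [1 - (1 - x i) E w_i]. *)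
    have -> : (1 - 'X) * rootPolyD1 x i = (1 - x i) *: rootPolyD1 x i - w.
      by rewrite /w (rootPoly_D1 x i) -mul_polyC polyCB; ring.
    by rewrite ED EN EZ Ew lerBlDr [mu + 1]addrC.
  rewrite ct UE sx -scalerAr -scalerAr; congr (_ *: _).
  have -> : 1 - 'X^2 = (1 - 'X) * (1 + 'X) :> {poly R} by ring.
  have -> : (1 - 'X) * (1 + 'X) * (A * rootPoly r x) = (1 - 'X) * A * w by rewrite wE; ring.
  by rewrite /w (rootPoly_D1 x i); ring.
(* As [1 + mu = 2 / (1 + c)], a ratio above [(1 - c) / 2] is what makes the interlacing bound
   positive. *)
have contra y : (forall i, (i < r.+1)%N -> x i <= y i) ->
    (forall i j, (i < j < r.+1)%N -> y j <= x i) -> 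
    (1 - c) / 2 < (rootPoly r.+1 y).[1] / (rootPoly r.+1 x).[1] ->
    0 < E (rootPoly r.+1 y).
  move=> xy yx lt_ratio.
  apply: lt_le_trans (interlacing_functional_ge ED EZ xdecr _ xy yx Ew ED1) => //.
  set rho := (rootPoly r.+1 y).[1] / _ in lt_ratio *.
  have -> : 1 + mu = 2 / (1 + c) by rewrite /mu; field; lra.
  by rewrite subr_gt0 mulrAC ltr_pdivrMr ?mul1r; lra.
have Esgn p : (forall t, -1 <= t <= c -> 0 <= p.[t]) -> 0 <= (-1) ^+ e * E p.
  move=> p0; rewrite /E mulrA -expr2 sqrr_sign mul1r; apply: quad_ge0 => k kn.
  by rewrite hornerM mulr_ge0 ?A0 ?p0 ?nodeI.
have hE m z t : (rootPoly m z).[t] = \prod_(i < m) (t - z i).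
  by rewrite /rootPoly horner_prod; apply: eq_bigr => i _; rewrite hornerXsubC.
case: (e) UE @E ED EZ EN Ew ED1 contra Esgn => UE E ED EZ EN Ew ED1 contra Esgn.
  (* Case [e = -1]: the roots [x 0, x 0, x 2, x 2, ...] give a product nonnegative on [[-1, c]], an
     unpaired last factor being [t + 1]. Strictness of the ratio comes from [x 0 < c]. *)
  have : 0 < E (rootPoly r.+1 (pairUp x)).
    apply: contra => [i ir|i j /andP[ij jr]|].
    - by rewrite /pairUp xle //; lia.
    - by rewrite /pairUp xle //; lia.
    apply: lt_le_trans (rootPoly_ratio_ge (k := r) (x := x) (y := pairUp x) _ _ _ _) => //.
    - rewrite /pairUp /= ltr_pM2r ?invr_gt0 // ltrD2l ltrN2.
      by case: (posnP r) => [r0|/xI/andP[]//]; move: xr; rewrite r0 => ->.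
    - by move=> i ir; rewrite /pairUp xle //; lia.
    exact: x1.
  have : 0 <= (-1) ^+ true * E (rootPoly r.+1 (pairUp x)).
    apply: Esgn => t /andP[t1 _]; rewrite hE; apply: prod_pairUp_ge0 => _.
    by rewrite xr.
  by rewrite mulN1r oppr_ge0 => /le_lt_trans h /h; rewrite ltxx.
have [r0|r0] := posnP r; last first.
  (* Case [e = 1] with [r > 0]: the roots are [c, x 1, x 1, x 3, x 3, ...]. The factor [t - c] makes
     the product nonpositive on [[-1, c]], and [x 1 < x 0] makes the ratio strict. *)
  pose y i := if i is j.+1 then pairUp (x \o succn) j else c.
  have : 0 < E (rootPoly r.+1 y).
    apply: contra => [[|i] ir|i [//|j] /andP[ij jr]|].
    - by rewrite ltW //; case/andP: (xI _ r0).
    - by rewrite /y /pairUp /= xle //; lia.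
    - by rewrite /y /pairUp /= xle //; lia.
    apply: (rootPoly_ratio_gt (k := r) (x := x) (y := y)) => //.
    - by move=> i ir; rewrite /y /pairUp /= xle //; lia.
    - by rewrite /y /pairUp /= xdecr.
  have : 0 <= (-1) ^+ false * E (- rootPoly r.+1 y).
    apply: Esgn => t /andP[t1 tc]; rewrite hornerN hE big_ord_recl /= oppr_ge0.
    rewrite mulr_le0_ge0 ?subr_le0 //; apply: prod_pairUp_ge0 => _.
    by rewrite /= prednK // xr.
  by rewrite mul1r EN oppr_ge0 => /le_lt_trans h /h; rewrite ltxx.
have s0 : s = [::] by apply: size0nil.
have UA : sinQuot a = A by rewrite UE s0 big_nil mulr1 scale1r.
split=> [z zc|k kn kc]; first by rewrite UA A0.
(* With [r = 0] only the condition at [pi] remains, where [x 0 = -1] and [w_0 = 1]. *)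
have E1 : (1 + c) * E 1 <= 1.
  have := ED1 ord0; rewrite /= -{1}r0 xr /rootPolyD1 big1; last first.
    by case=> i; rewrite r0 => /= ir; rewrite -val_eqE /=; case: i ir.
  have -> : 1 + mu = 2 / (1 + c) by rewrite /mu; field; lra.
  by rewrite ler_pdivlMr; nra.
have Ac k' : (k' < n.+1)%N -> 0 <= (A * (c%:P - 'X)).[node n k'].
  move=> kn'; have /andP[h1 h2] := nodeI _ kn'.
  by rewrite hornerM !hornerE mulr_ge0 ?subr_ge0 // A0 // h1.
(* Here [w = 1 + X], so [c - X = (1 + c) - w] and [E1] bounds the quadrature above by zero, while
   its terms are nonnegative. *)
have q0 : quad n (A * (c%:P - 'X)) = 0.
  apply/eqP; rewrite eq_le quad_ge0 // andbT.
  have -> : quad n (A * (c%:P - 'X)) = E ((1 + c) *: 1 - w).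
    rewrite /E mul1r wE r0 /rootPoly big_ord0 mul1r; congr (quad n (A * _)).
    by rewrite -mul_polyC polyCD mulr1; ring.
  by rewrite ED EN EZ Ew subr_le0.
have := quad_eq0 Ac q0 (k := k) kn; rewrite hornerM !hornerE -UA => /eqP.
rewrite mulf_eq0 => /orP[/eqP //|]; rewrite subr_eq0 => /eqP h.
by move: kc; rewrite -h ltxx.
Qed.

End UpperBound.

(** * Polynomials determined by double zeros at the nodes *)

Section ExtremalShape.
Context {R : realType}.
Implicit Types (n k : nat).

(* [M] collects the interior nodes other than the largest one, doubly since a
   nonnegative polynomial cannot vanish simply there, and -1 when it is a node. *)
Lemma node_shape n : exists M : {poly R}, forall U : {poly R}, (size U <= n)%N ->
  (forall x, -1 <= x <= node n 0 -> 0 <= U.[x]) ->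
  (forall k, (k <= n)%N -> node n k < node n 0 :> R -> U.[node n k] = 0) ->
  exists g, U = g *: M.
Proof.
case: n => [|n].
  by exists 0 => U; rewrite leqn0 size_poly_eq0 => /eqP ->; exists 0; rewrite scaler0.
(* With [n] shifted by one, the indices [1] to [K] give the nodes strictly between [-1] and the
   largest one. *)
pose K := n./2; pose s := [seq (node n.+1 k.+1 : R) | k <- iota 0 K].
have sI : {in s, forall x, -1 < x < node n.+1 0}.
  move=> x /mapP[k]; rewrite mem_iota add0n /= => kK ->.
  have kn : (k.+1.*2 < n.+1)%N by rewrite /K in kK; lia.
  apply/andP; split; last by rewrite node_lt // ltnW.
  have kI : angle n.+1 k.+1 \in `[0, pi : R] by rewrite angle_itv // ltnW.
  rewrite -cospi ltr_cos //; last by rewrite in_itv /= lexx pi_ge0.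
  by rewrite /angle mulrA ltr_pdivrMr ?ltr0n // mulrC ltr_pM2l ?pi_gt0 // ltr_nat.
have us : uniq s.
  rewrite map_inj_in_uniq ?iota_uniq // => j k; rewrite !mem_iota !add0n /= => jK kK jk.
  have [lt|lt|//] := ltngtP j k.
    have := @node_lt R n.+1 j.+1 k.+1; rewrite jk ltxx ltnS lt => /(_ isT).
    by rewrite /K in kK; lia.
  have := @node_lt R n.+1 k.+1 j.+1; rewrite jk ltxx ltnS lt => /(_ isT).
  by rewrite /K in jK; lia.
pose Q : {poly R} := \prod_(x <- s) ('X - x%:P).
have Qm : Q \is monic by exact: monic_prod_XsubC.
have sQ : size Q = K.+1 by rewrite size_prod_XsubC size_map size_iota.
exists ((if odd n then 'X + 1 else 1) * (Q * Q)) => U sU U0 Uz.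
have Us : {in s, forall x, U.[x] = 0}.
  move=> x xs; have /andP[_ xc] := sI x xs.
  move: xs xc => /mapP[k]; rewrite mem_iota add0n => /= kK -> xc.
  by apply: Uz => //; rewrite /K in kK; lia.
have [|V UV] := poly_double_roots us sI _ Us.
  by move=> x /andP[/ltW ? /ltW ?]; apply: U0; apply/andP.
have {}UV : U = V * (Q * Q) by rewrite UV prodrXl expr2.
have QQm : Q * Q \is monic by rewrite monicMl.
have sQQ : size (Q * Q) = K.*2.+1 by rewrite size_Mmonic ?monic_neq0 // sQ addSn addnS /= addnn.
have [V0|V0] := eqVneq V 0; first by exists 0; rewrite UV V0 mul0r scale0r.
(* Once the [K] double zeros are removed, [V] is constant, or at most linear for odd [n]; then [-1]
   is a node and supplies the last zero. *)
have sV : (size V <= 1 + odd n)%N.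
  move: sU; rewrite UV size_Mmonic // sQQ addnS /= => sU.
  by have := odd_double_half n; rewrite -/K; lia.
case: (boolP (odd n)) sV => [on|_] sV; last first.
  by exists V`_0; rewrite mul1r UV {1}(size1_polyC sV) mul_polyC.
have nodeN1 : node n.+1 K.+1 = -1 :> R.
  rewrite -cospi /node /angle; congr cos.
  have -> : K.+1.*2.+1 = n.+2 by have := odd_double_half n; rewrite -/K on; lia.
  by rewrite mulrCA mulfV ?mulr1 // pnatr_eq0.
have VN1 : root V (-1).
  have : U.[-1] = 0.
    rewrite -nodeN1; apply: Uz; first by have := odd_double_half n; rewrite -/K on; lia.
    rewrite nodeN1 (lt_le_trans (y := 0)) ?ltrN10 //.
    exact: node0_ge0.
  rewrite UV !hornerM => /eqP; rewrite mulf_eq0 => /orP[//|].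
  rewrite mulf_eq0 orbb -rootE root_prod_XsubC => /sI.
  by rewrite ltxx.
have /factor_theorem [W VW] := VN1.
have W0 : W != 0 by apply: contraNneq V0 => W0; rewrite VW W0 mul0r.
have sW : (size W <= 1)%N.
  by move: sV; rewrite VW size_Mmonic ?monicXsubC // size_XsubC addn2.
exists W`_0; rewrite UV VW {1}(size1_polyC sW) polyCN opprK -mul_polyC.
by ring.
Qed.

End ExtremalShape.

(** * Fejer kernels and the extremal vector *)

Section ExtremalPolynomial.
Context {R : realType}.
Implicit Types (n : nat) (x t : R).

Definition dirichlet n x : R := 1 + 2 * \sum_(j < n) cos (j.+1%:R * x).

Lemma dirichletE n x :
  (1 - cos x) * dirichlet n x = cos (n%:R * x) - cos (n.+1%:R * x).
Proof.
elim: n => [|n IH].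
  by rewrite /dirichlet big_ord0 mulr0 addr0 mul0r cos0 mul1r mulr1.
have -> : dirichlet n.+1 x = dirichlet n x + 2 * cos (n.+1%:R * x).
  by rewrite /dirichlet big_ord_recr /=; ring.
rewrite mulrDr IH.
have -> : n.+2%:R * x = n.+1%:R * x + x by rewrite [n.+2%:R]mulrSr mulrDl mul1r.
have -> : n%:R * x = n.+1%:R * x - x by rewrite [n.+1%:R]mulrSr mulrDl mul1r addrK.
by rewrite cosB cosD; ring.
Qed.

(* (n + 1) times the Fejer kernel of order n + 1. *)
Definition fejer n x : R :=
  n.+1%:R + 2 * \sum_(j < n) (n%:R - j%:R) * cos (j.+1%:R * x).

Lemma fejerS n x : fejer n.+1 x = fejer n x + dirichlet n.+1 x.
Proof.
have E : \sum_(j < n.+1) (n.+1%:R - j%:R) * cos (j.+1%:R * x) =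
    \sum_(j < n) (n%:R - j%:R) * cos (j.+1%:R * x) + \sum_(j < n.+1) cos (j.+1%:R * x).
  rewrite [in RHS]big_ord_recr big_ord_recr /= addrA -big_split /=; congr (_ + _).
    by apply: eq_bigr => j _; rewrite mulrSr; ring.
  by rewrite mulrSr addrAC subrr add0r mul1r.
rewrite /fejer /dirichlet E [n.+2%:R]mulrSr; ring.
Qed.

Lemma fejerE n x : (1 - cos x) * fejer n x = 1 - cos (n.+1%:R * x).
Proof.
elim: n => [|n IH]; first by rewrite /fejer big_ord0 mulr0 addr0 mul1r mulr1.
by rewrite fejerS mulrDr IH dirichletE; ring.
Qed.

Lemma fejer0 n : fejer n 0 = n.+1%:R ^+ 2.
Proof.
have D m : dirichlet m 0 = 1 + 2 * m%:R.
  rewrite /dirichlet (eq_bigr (fun=> 1)) ?sumr_const ?card_ord // => j _.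
  by rewrite mulr0 cos0.
elim: n => [|n IH]; first by rewrite /fejer big_ord0 mulr0 addr0 expr1n.
by rewrite fejerS IH D [n.+2%:R]mulrSr; ring.
Qed.

Lemma cos_lt1 x : 0 < x < pi *+ 2 -> cos x < 1.
Proof.
move=> /andP[x0 x2]; rewrite lt_neqAle cos_le1 andbT; apply/negP => /eqP cx.
have inI (y : R) : 0 < y <= pi -> cos y <> 1.
  move=> /andP[y0 yp]; rewrite -cos0 => /cos_inj; rewrite !in_itv /= lexx pi_ge0 yp ltW //.
  by move=> /(_ isT isT) y00; move: y0; rewrite y00 ltxx.
have [xp|xp] := leP x pi; first by apply: (inI x _ cx); rewrite x0.
have cx' : cos (pi *+ 2 - x) = 1.
  by rewrite -cosN opprB -[RHS]cx -[in RHS](subrK (pi *+ 2) x) cosD2pi.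
apply: (inI _ _ cx'); rewrite subr_gt0 x2 lerBlDr mulr2n lerD2l.
exact: ltW.
Qed.

Section Extremal.
Context (n : nat).
Hypothesis n0 : (0 < n)%N.
Let N : R := n.+1%:R.
Let al : R := pi / N.
Let T : R := tan (pi / (2 * N)).
Let c : R := node n 0.
Let a := extremal_coeffs R n.

Let N_gt0 : 0 < N. Proof. by rewrite ltr0n. Qed.

Let al_gt0 : 0 < al. Proof. by rewrite divr_gt0 ?pi_gt0. Qed.

Let al_le : al <= pi / 2.
Proof. by rewrite ler_wpM2l ?pi_ge0 // lef_pV2 ?posrE // ler_nat. Qed.

Let al_lt : al < pi. Proof. by apply: le_lt_trans al_le _; have := @pi_gt0 R; lra. Qed.

Let Nal : N * al = pi. Proof. by rewrite /al mulrCA mulfV ?mulr1 // gt_eqF. Qed.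

Let cE : c = cos al. Proof. exact: node0. Qed.

Let sal_gt0 : 0 < sin al. Proof. by rewrite sin_gt0_pi // al_gt0 al_lt. Qed.

Let T_E : (1 + c) * T = sin al.
Proof.
set h := pi / (2 * N).
have alh : al = h *+ 2 by rewrite -[RHS]mulr_natl /h /al; field; rewrite gt_eqF.
have h0 : 0 < cos h.
  apply: cos_gt0_pihalf; have := al_le; have := al_gt0; have := @pi_gt0 R.
  by rewrite alh mulr2n => *; apply/andP; split; lra.
rewrite /T -/h /tan cE alh cos_mulr2n sin_mulr2n; field.
by rewrite gt_eqF.
Qed.

Let T_gt0 : 0 < T.
Proof.
have c0 : 0 <= c := node0_ge0 n0.
by rewrite -(pmulr_rgt0 (x := 1 + c)) ?T_E //; lra.
Qed.

(** [2 sin (j t) sin (j al)] is the difference of the cosines of [j (t - al)] and [j (t + al)], and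
    the weights [1 - j / N] are those of the Fejer kernel. *)
Let sinE t : sinPoly a t = T / (2 * N) * (fejer n (t - al) - fejer n (t + al)).
Proof.
rewrite /fejer opprD addrACA subrr add0r -mulrBr -sumrB /sinPoly !mulr_sumr.
apply: eq_bigr => j _; rewrite /a mxE -/N -/T.
have -> : pi * j.+1%:R / N = j.+1%:R * al by rewrite /al; ring.
rewrite [_ * (t - al)]mulrBr [_ * (t + al)]mulrDr cosB cosD.
have -> : n%:R = N - 1 by rewrite /N [n.+1%:R]mulrSr addrK.
rewrite [j.+1%:R in X in _ * X * _ * _]mulrSr; move: (sin _) (cos _) (sin _) (cos _) => *.
by field; rewrite gt_eqF.
Qed.

Let cosNB t : cos (N * (t - al)) = - cos (N * t).
Proof. by rewrite mulrBr Nal cosB cospi sinpi; ring. Qed.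

Let cosND t : cos (N * (t + al)) = - cos (N * t).
Proof. by rewrite mulrDr Nal cosD cospi sinpi; ring. Qed.

(** The denominators [1 - cos (t - al)] and [1 - cos (t + al)] of the two kernels multiply to
    [(cos t - c)^2], and [N al = pi] gives both the numerator [1 + cos (N t)]. *)
Let quotientE t : sin t != 0 ->
  (cos t - c) ^+ 2 * (sinQuot a).[cos t] = T * sin al / N * (1 + cos (N * t)).
Proof.
move=> st; apply: (mulfI st).
have -> : sin t * ((cos t - c) ^+ 2 * (sinQuot a).[cos t]) = (cos t - c) ^+ 2 * sinPoly a t.
  by rewrite sinPolyE; ring.
have -> : (cos t - c) ^+ 2 = (1 - cos (t - al)) * (1 - cos (t + al)).
  rewrite cosB cosD cE.
  have h1 := cos2Dsin2 t; have h2 := cos2Dsin2 al.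
  have -> : (1 - (cos t * cos al + sin t * sin al)) * (1 - (cos t * cos al - sin t * sin al)) =
    1 - 2 * cos t * cos al + cos t ^+ 2 * cos al ^+ 2 - sin t ^+ 2 * sin al ^+ 2 by ring.
  by rewrite !sin2cos2; ring.
have f1 := fejerE n (t - al); have f2 := fejerE n (t + al).
rewrite -/N cosNB opprK in f1; rewrite -/N cosND opprK in f2.
rewrite sinE.
have -> : (1 - cos (t - al)) * (1 - cos (t + al)) *
    (T / (2 * N) * (fejer n (t - al) - fejer n (t + al))) =
    T / (2 * N) * ((1 - cos (t + al)) * ((1 - cos (t - al)) * fejer n (t - al)) -
      (1 - cos (t - al)) * ((1 - cos (t + al)) * fejer n (t + al))) by ring.
rewrite f1 f2 cosB cosD; field.
by rewrite gt_eqF.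
Qed.

(** At [t = al] both sides of [quotientE] vanish, so the value of [U] at [c] has to be read off the
    kernels, at [0] and at [2 al]. *)
Let sin_al : sinPoly a al = T * N / 2.
Proof.
rewrite sinE subrr fejer0 -/N.
have -> : fejer n (al + al) = 0.
  have := fejerE n (al + al); rewrite -/N.
  have -> : cos (N * (al + al)) = 1 by rewrite mulrDr Nal -mulr2n cos2pi.
  rewrite subrr => /eqP; rewrite mulf_eq0 subr_eq0 => /orP[/eqP h|/eqP//].
  have : cos (al + al) < 1.
    apply: cos_lt1; rewrite addr_gt0 // mulr2n.
    by have := al_lt; lra.
  by rewrite -h ltxx.
by rewrite subr0; field; rewrite gt_eqF.
Qed.

Let quotient_c : (sinQuot a).[c] * sin al = T * N / 2.
Proof. by rewrite -sin_al sinPolyE -cE mulrC. Qed.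

(* At [t = pi], where [sin] vanishes, the identity is obtained by continuity. *)
Let quotientE' t : 0 < t <= pi ->
  (cos t - c) ^+ 2 * (sinQuot a).[cos t] = T * sin al / N * (1 + cos (N * t)).
Proof.
move=> /andP[t0]; rewrite le_eqVlt => /predU1P[->|tp]; last first.
  by apply: quotientE; rewrite gt_eqF // sin_gt0_pi // t0.
pose F t := (cos t - c) ^+ 2 * (sinQuot a).[cos t] - T * sin al / N * (1 + cos (N * t)).
suff : F pi = 0 by move/eqP; rewrite subr_eq0 => /eqP.
have cF : F x @[x --> pi] --> F pi.
  apply: cvgB.
    apply: cvgM; last first.
      by apply: continuous_comp; [exact: continuous_cos | exact: continuous_horner].
    rewrite expr2; apply: cvgM; apply: cvgB; [exact: continuous_cos | exact: cvg_cst
      | exact: continuous_cos | exact: cvg_cst].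
  apply: cvgMr; apply: cvgD; first exact: cvg_cst.
  apply: (@continuous_comp _ _ _ ( *%R N) cos); last exact: continuous_cos.
  by apply: cvgMr; exact: cvg_id.
apply: (cvg_unique _ (cvg_at_left_filter cF)) => //.
apply: cvg_near_cst; near=> t1; apply/eqP; rewrite subr_eq0; apply/eqP.
apply: quotientE; rewrite gt_eqF // sin_gt0_pi //; apply/andP; split; near: t1.
  by apply: nbhs_left_gt; exact: pi_gt0.
exact: nbhs_left_lt.
Unshelve. all: by end_near. Qed.

Lemma extremal_quotient_ge0 x : -1 <= x < 1 -> 0 <= (sinQuot a).[x].
Proof.
move=> /andP[xl xu]; have [->|xc] := eqVneq x c.
  by rewrite -(pmulr_lge0 _ sal_gt0) quotient_c divr_ge0 // mulr_ge0 // ltW.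
have ct : cos (acos x) = x by rewrite acosK // in_itv /= xl ltW.
have acI : 0 < acos x <= pi.
  by apply/andP; split; [rewrite acos_gt0 ?xl | rewrite acos_lepi // xl ltW].
have := quotientE' acI; rewrite ct => h.
rewrite -(pmulr_rge0 (x := (x - c) ^+ 2)) ?exprn_even_gt0 ?subr_eq0 // h.
apply: mulr_ge0; first by rewrite ltW // divr_gt0 // mulr_gt0.
by have := cos_geN1 (N * acos x); lra.
Qed.

Lemma extremal_quotient_node k : (k <= n)%N -> node n k < c -> (sinQuot a).[node n k] = 0.
Proof.
move=> kn; have [j jn ->] := @node_half R n k kn => jc.
have jI : 0 < (angle n j : R) <= pi.
  have := @angle_itv R n j jn; rewrite in_itv /= => /andP[_ h].
  by apply/andP; split=> //; apply: mulr_gt0; [rewrite ltr0n | exact: al_gt0].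
have := quotientE' jI.
have -> : cos (N * angle n j) = -1.
  rewrite /angle mulrCA -/N -/al Nal.
  rewrite -natr1 mulrDl mul1r addrC -muln2 natrM -mulrA mulr_natl [2 * pi]mulr_natl.
  by rewrite periodicn ?cospi //; exact: cosD2pi.
rewrite subrr mulr0 => /eqP; rewrite mulf_eq0 expf_eq0 /= subr_eq0 => /orP[|/eqP//].
by rewrite lt_eqF.
Qed.


Let node_lt0 k : (0 < k < n)%N -> node n k < c.
Proof.
move=> /andP[k0 kn]; have [k2|k2] := leqP k.*2 n; first exact: node_lt.
by rewrite -node_rev ?(ltnW kn) //; apply: node_lt; lia.
Qed.

(** The node [c] occurs twice, at the distinct indices [0] and [n]. *)
Let quadE p : (forall k, (0 < k < n)%N -> p.[node n k] = 0) -> quad n p = 2 / N * p.[c].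
Proof.
have cn : node n n = c by rewrite -(node_rev (leqnn n)) subnn.
move: n0 cn; rewrite /quad /c /N; case: (n) => // m _ cn p0.
rewrite big_ord_recl big_ord_recr /= big1 => [|i _]; last first.
  by apply: p0; rewrite /= /bump /= add1n ltnS ltn_ord.
by rewrite /bump /= add1n cn; ring.
Qed.

Let quotient_inner k : (0 < k < n)%N -> (sinQuot a).[node n k] = 0.
Proof. by move=> kn; rewrite extremal_quotient_node ?node_lt0 //; lia. Qed.

Lemma extremal_normalized : normalized a.
Proof.
suff : cosPoly a 0 = 1.
  by rewrite /normalized => <-; apply: eq_bigr => j _; rewrite mulr0 cos0 mulr1.
rewrite cosPoly0_quad quadE => [|k kn]; last by rewrite hornerM quotient_inner ?mulr0.
apply: (mulIf (lt0r_neq0 sal_gt0)); rewrite mul1r.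
have -> : 2 / N * ((1 + 'X) * sinQuot a).[c] * sin al =
    2 / N * (1 + c) * ((sinQuot a).[c] * sin al) by rewrite hornerM hornerD hornerC hornerX; ring.
by rewrite quotient_c -T_E; field; rewrite gt_eqF.
Qed.

Lemma extremal_cosPoly_pi : cosPoly a pi = - T ^+ 2.
Proof.
have c0 : 0 <= c := node0_ge0 n0.
have := @tan_half R n n0; rewrite /= -/c -/N -/T => ->.
(* Multiplying by [cosPoly a 0 = 1] makes both sides quadratures concentrated at [c], with the same
   factor [U(c)]. *)
have -> : (1 - c) / (1 + c) = (1 - c) / (1 + c) * cosPoly a 0.
  by rewrite (cosPoly0 extremal_normalized) mulr1.
rewrite cosPolypi_quad cosPoly0_quad !quadE => [|k kn|k kn].
- rewrite !hornerM !hornerD hornerN !hornerC hornerX; field.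
  by rewrite !gt_eqF //; lra.
- by rewrite hornerM quotient_inner ?mulr0.
- by rewrite hornerM quotient_inner ?mulr0.
Qed.

(** [S] is nonnegative on [(0, pi)], so it is negative on neither side of any point; the minimum is
    then taken at [pi] alone. *)
Lemma extremal_sign_changes : sign_changes a = set0.
Proof.
apply/seteqP; split=> // t [/andP[t0 tp] [_ tc]].
have a_ge0 : \forall t' \near t, 0 <= sinPoly a t'.
  near=> t'; have /andP[t1 t2] : 0 < t' < pi.
    by apply/andP; split; near: t'; [exact: lt_nbhsr | exact: lt_nbhsl].
  rewrite sinPolyE mulr_ge0 ?sin_ge0_pi ?(ltW t1) ?(ltW t2) //.
  by rewrite extremal_quotient_ge0 // cos_geN1 cos_lt1 // t1 mulr2n (lt_trans t2) // ltrDl pi_gt0.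
have l0 : \forall t' \near t^'-, 0 <= sinPoly a t'.
  by rewrite /at_left near_withinE; apply: filterS a_ge0.
have r0 : \forall t' \near t^'+, 0 <= sinPoly a t'.
  by rewrite /at_right near_withinE; apply: filterS a_ge0.
by case: tc => [[L _]|[_ L]];
  [apply: (@filter_not_empty _ (t^'-) _); apply: filterS2 L l0
  | apply: (@filter_not_empty _ (t^'+) _); apply: filterS2 L r0] => t' h;
  rewrite leNgt h.
Unshelve. all: by end_near. Qed.

End Extremal.
End ExtremalPolynomial.

(** * Existence of the minimum, the maximal value and uniqueness *)

Section Extremality.
Context {R : realType} (n : nat).
Hypothesis n0 : (0 < n)%N.
Implicit Types a : 'rV[R]_n.
Let T : R := tan (pi / (2 * n.+1%:R)).

Lemma finite_is_min (A : set R) (s : seq R) :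
  A !=set0 -> (forall x, A x -> x \in s) -> exists m, is_min A m.
Proof.
elim: s A => [|v s IH] A [x Ax] As; first by have := As x Ax.
have [[y [Ay yv]]|Av] := pselect (exists y, A y /\ y != v); last first.
  have Ev y : A y -> y = v.
    by move=> Ay; apply/eqP/negP => yv; apply: Av; exists y; split=> //; apply/negP.
  by exists x; split=> // y Ay; rewrite (Ev x Ax) (Ev y Ay).
have [||m [[Am mv] mA]] := IH [set u | A u /\ u != v]; first by exists y.
  by move=> u [/As]; rewrite inE => /predU1P[->|//]; rewrite eqxx.
have [vm|vm] := pselect (A v /\ v < m).
  exists v; split; first by case: vm.
  move=> u Au; have [->//|uv] := eqVneq u v.
  by rewrite (le_trans (ltW vm.2)) // mA.
exists m; split=> // u Au; have [uv|uv] := eqVneq u v; last exact: mA.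
by rewrite uv leNgt; apply/negP => h; apply: vm; split=> //; rewrite -uv.
Qed.

Lemma sinQuot_neq0 a : normalized a -> sinQuot a != 0.
Proof.
move=> na; apply/eqP => U0; have := cosPoly0_quad a.
by rewrite cosPoly0 // U0 mulr0 quad0 => /eqP; rewrite oner_eq0.
Qed.

(** Sign changes are [acos] of roots of [sinQuot a], which normalization makes nonzero, so only
    finitely many values compete. *)
Lemma exists_min_value a : normalized a -> exists m, is_min_value a m.
Proof.
move=> na; have [s sP] := poly_roots_seq (sinQuot_neq0 na).
apply: (@finite_is_min _ (cosPoly a pi :: [seq cosPoly a (acos x) | x <- s])).
  by exists (cosPoly a pi); exists pi => //; right.
move=> _ [t [[/andP[t0 tp] [St _]]|->] <-]; rewrite inE ?eqxx //; apply/orP; right.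
apply/mapP; exists (cos t); last by rewrite cosK // in_itv /= !ltW.
apply: sP; move: St => /eqP; rewrite sinPolyE mulf_eq0 rootE gt_eqF //.
by rewrite sin_gt0_pi // t0.
Qed.

Lemma min_value_le_pi a m : is_min_value a m -> m <= cosPoly a pi.
Proof. by case=> _; apply; exists pi => //; right. Qed.

Lemma min_value_le_sign_change a m t :
  is_min_value a m -> sign_changes a t -> m <= cosPoly a t.
Proof. by move=> [_ h] st; apply: h; exists t => //; left. Qed.

Lemma extremal_min_value : is_min_value (extremal_coeffs R n) (- T ^+ 2).
Proof.
rewrite /is_min_value extremal_sign_changes // set0U image_set1 extremal_cosPoly_pi //.
by split=> // _ ->.
Qed.

(** Both quotients are multiples of one polynomial, and normalization fixes the factor. Assuming
    only an inequality on [m] lets the lemma prove the upper bound too: a larger minimum would force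
    the extremal vector, whose value at [pi] is [- T ^+ 2]. *)
Lemma extremal_unique a m : normalized a -> is_min_value a m -> - T ^+ 2 <= m ->
  a = extremal_coeffs R n.
Proof.
move=> na am Tm; have na0 := @extremal_normalized R n n0.
have T2 := @tan_half R n n0.
have [t st||U0 Uz] := @extremal_quotient R n a n0 na.
- by rewrite -T2 (le_trans Tm) // min_value_le_sign_change.
- by rewrite -T2 (le_trans Tm) // min_value_le_pi.
have [M MP] := @node_shape R n.
have [g aM] := MP _ (size_sinQuot a) U0 Uz.
have [||g' aM'] := MP _ (size_sinQuot (extremal_coeffs R n)).
- move=> x /andP[x1 xc]; rewrite extremal_quotient_ge0 // x1.
  by rewrite (le_lt_trans xc) // node0_lt1.
- exact: extremal_quotient_node.
have q (b : 'rV[R]_n) h : normalized b -> sinQuot b = h *: M -> h * quad n ((1 + 'X) * M) = 1.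
  by move=> nb bM; rewrite -[RHS](cosPoly0 nb) cosPoly0_quad bM -[_ * (_ *: M)]scalerAr quadZ.
apply: sinQuot_inj; rewrite aM aM'; congr (_ *: _).
have q0 : quad n ((1 + 'X) * M) != 0.
  by apply: contra_eqN (q _ _ na aM) => /eqP ->; rewrite mulr0 eq_sym oner_eq0.
by apply: (mulIf q0); rewrite (q _ _ na aM) (q _ _ na0 aM').
Qed.

End Extremality.

Theorem mainTheorem2 (R : realType) (n : nat) (hn : (1 <= n)%N) :
  [/\ (* the minimum is attained for every admissible coefficient vector *)
      forall a : 'rV[R]_n, normalized a -> exists m : R, is_min_value a m,
      (* the maximum of these minima *)
      is_max [set m : R | exists a : 'rV[R]_n, normalized a /\ is_min_value a m]
             (- tan (pi / (2 * n.+1%:R)) ^+ 2)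
    & (* the unique extremal coefficient vector *)
      forall a : 'rV[R]_n,
        normalized a /\ is_min_value a (- tan (pi / (2 * n.+1%:R)) ^+ 2)
        <-> a = extremal_coeffs R n].
Proof.
split; first exact: exists_min_value.
- split.
    exists (extremal_coeffs R n); split; first exact: extremal_normalized.
    exact: extremal_min_value.
  move=> m [a [na am]]; rewrite leNgt; apply/negP => Tm.
  have aE := extremal_unique hn na am (ltW Tm).
  have := min_value_le_pi am; rewrite aE extremal_cosPoly_pi //.
  by rewrite leNgt Tm.
- move=> a; split=> [[na am]|->]; first exact: (extremal_unique hn na am (lexx _)).
  by split; [exact: extremal_normalized | exact: extremal_min_value].
Qed.
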